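(* Let $X$ be a nonempty closed convex subset of a real Hilbert space $H$ and let $F:X\to H$ be monotone on $X$. Let $X^*$ be the solution set of the variational inequality problem for $(F,X)$; assume $X^*$ is nonempty, closed and convex, and weakly sharp with modulus $\alpha>0$. Let $a>0$, let $\gamma_n\in[a,+\infty)$ for all $n\ge 1$, let $x_1\in H$, and let $\{x_n\}$ be a sequence satisfying $x_{n+1}\in X$ and $$x_{n+1}=P_X\big(x_n-\gamma_nF(x_{n+1})\big),\quad n=1,2,\dots.$$ Then $\{x_n\}$ converges to a point of $X^*$ in at most $\ell$ iterations, i.e. there is a positive integer $\ell$ with $$\ell\le\frac{\mathrm{dist}(x_1,X^* )^2}{a^2\alpha^2}+1$$ such that $x_{\ell+1}\in X^*$ and $x_n=x_{\ell+1}$ for all $n\ge\ell+1$.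
   Context: $H$ is a real Hilbert space with inner product $\langle\cdot,\cdot\rangle$, norm $\|\cdot\|$ and closed unit ball $\mathbb{B}$. The solution set is $X^*=\{x^*\in X : \langle F(x^* ),x-x^*\rangle\ge 0 \text{ for all } x\in X\}$. $F$ is monotone on $X$ if $\langle F(x)-F(y),x-y\rangle\ge 0$ for all $x,y\in X$. $\mathrm{dist}(x,C)=\inf_{y\in C}\|y-x\|$, and $P_C(x)$ is the unique point of a nonempty closed convex set $C$ nearest to $x$. The polar of $C\subseteq H$ is $C^\circ=\{u\in H:\langle u,x\rangle\le 0\ \text{for all } x\in C\}$. For a closed convex set $C$ and $x\in C$, the tangent cone is $T_C(x)=\mathrm{cl}\big(\bigcup_{\lambda>0}\frac{C-x}{\lambda}\big)$ and the normal cone is $N_C(x)=[T_C(x)]^\circ$. $X^*$ is called weakly sharp if $-F(x^* )\in\mathrm{int}\Big(\bigcap_{x\in X^*}\big[T_X(x)\cap N_{X^*}(x)\big]^\circ\Big)$ for all $x^*\in X^*$. $X^*$ is weakly sharp with modulus $\alpha>0$ if it is weakly sharp and $\alpha\mathbb{B}\subset F(x^* )+[T_X(x^* )\cap N_{X^*}(x^* )]^\circ$ for every $x^*\in X^*$; equivalently (for this last inclusion) $\langle F(x^* ),v\rangle\ge\alpha\|v\|$ for all $x^*\in X^*$ and all $v\in T_X(x^* )\cap N_{X^*}(x^* )$. *)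

(* Defs.v *)
From HB Require Import structures.
From mathcomp Require Import all_boot all_order all_algebra.
From mathcomp Require Import sesquilinear.
From mathcomp Require Import all_classical all_reals all_analysis.

Set Implicit Arguments.
Unset Strict Implicit.
Unset Printing Implicit Defensive.

Import Order.TTheory GRing.Theory Num.Theory.
Import numFieldNormedType.Exports.

Local Open Scope classical_set_scope.
Local Open Scope ring_scope.

(* A real Hilbert space is a complete normed module H over R : realType with an
   inner product dot that induces its norm: `|x| ^+ 2 = dot x x.
   A map X -> H is represented by a total function H -> H; all the notions
   below only use its values on X. *)

Section VariationalInequality.
Context {R : realType} {H : completeNormedModType R}.
Variable dot : {dot H for idfun}.
Implicit Types (C X S : set H) (F : H -> H) (x y u v : H).

Definition dist_set x C : R := inf [set `|y - x| | y in C].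

Definition nearest C x : set H :=
  [set p | C p /\ forall y, C y -> `|x - p| <= `|x - y|].

(* [nearest C x] is a singleton when C is nonempty, closed and convex and H is
   a Hilbert space; otherwise [get] may return its (irrelevant) default. *)
Definition metric_proj C x : H := get (nearest C x).

Definition polar C : set H := [set u | forall x, C x -> dot u x <= 0].

Definition tangent_cone C x : set H :=
  closure (\bigcup_(l in [set l : R | 0 < l]) [set l^-1 *: (y - x) | y in C]).

Definition normal_cone C x : set H := polar (tangent_cone C x).

Definition monotone_on X F : Prop :=
  forall x y, X x -> X y -> 0 <= dot (F x - F y) (x - y).

Definition VI_sol F X : set H :=
  [set xs | X xs /\ forall x, X x -> 0 <= dot (F xs) (x - xs)].

Definition sharp_cone F X x : set H :=
  polar (tangent_cone X x `&` normal_cone (VI_sol F X) x).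

Definition weakly_sharp F X : Prop :=
  forall xs, VI_sol F X xs ->
    (\bigcap_(x in VI_sol F X) sharp_cone F X x)° (- F xs).

Definition weakly_sharp_modulus F X (alpha : R) : Prop :=
  weakly_sharp F X /\
  forall xs, VI_sol F X xs ->
    [set alpha *: b | b in closed_ball (0 : H) 1] `<=`
    [set F xs + w | w in sharp_cone F X xs].

End VariationalInequality.

(* Main.v *)
Require Import Defs.
From HB Require Import structures.
From mathcomp Require Import all_boot all_order all_algebra.
From mathcomp Require Import sesquilinear.
From mathcomp Require Import all_classical all_reals all_analysis.
From mathcomp Require Import ring lra.

Import Order.TTheory GRing.Theory Num.Theory.
Import numFieldNormedType.Exports.

Local Open Scope classical_set_scope.
Local Open Scope ring_scope.

(** A step of the implicit iteration goes from [y] to [z = P_X (y - g F z)],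
    and this projection satisfies the variational inequality
      [dot (y - z) (w - z) <= g dot (F z) (w - z)]  for every [w] in [X].

    Taking for [w] a solution [s], the right-hand side is nonpositive because
    [F] is monotone and [s] solves the problem.  The angle at [z] between [y]
    and [s] is therefore at least right, so that
      [|z - s|^2 + |y - z|^2 <= |y - s|^2]  ([VI_step_fejer]).

    Suppose now that [z] is not a solution, and take for [w] the point [p] of
    the solution set nearest to [z].  The vector [z - p] lies in the tangent
    cone to [X] at [p], since [z] is in [X], and in the normal cone to the
    solution set at [p], since [p] is a projection; weak sharpness therefore
    gives [dot (F p) (z - p) >= alpha |z - p|], monotonicity carries this bound
    over to [F z], and the variational inequality together with Cauchy-Schwarz
    yields [|y - z| >= g alpha >= a alpha]  ([VI_step_length]).

    So each step that misses the solution set decreases the squared distance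
    to every solution by at least [a^2 alpha^2]; there are at most
    [dist(x_1, S)^2 / (a^2 alpha^2)] of them, [S] being the solution set.  Once
    the sequence has reached a solution [s], the first inequality with [y = s]
    forces [z = s].

    Both the projection defining the scheme and the projection onto the
    solution set have to exist: this is the classical argument by the
    parallelogram identity and completeness ([nearest_exists]). *)

(** * Inner product and projections *)

Section InnerProduct.
Context {R : realType} {H : completeNormedModType R}.
Variable dot : {dot H for idfun}.
Hypothesis norm_dot : forall x : H, `|x| ^+ 2 = dot x x.
Implicit Types (C : set H) (u v w x y z p : H).

Lemma dotC u v : dot u v = dot v u :> R.
Proof. by rewrite (hermC dot u v) expr0 mul1r. Qed.

Lemma dotZl (t : R) u v : dot (t *: u) v = t * dot u v :> R.
Proof. exact: (linearZl_LR dot). Qed.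

Lemma dotZr (t : R) u v : dot u (t *: v) = t * dot u v :> R.
Proof. by rewrite dotC dotZl dotC. Qed.

Lemma sqr_normB u v : `|u - v| ^+ 2 = `|u| ^+ 2 + `|v| ^+ 2 - 2 * dot u v.
Proof.
rewrite !norm_dot linearBl/= !linearBr/= (dotC v u); ring.
Qed.

(** The Cauchy-Schwarz inequality, read off from the square of
    [|v| u - |u| v]. *)
Lemma dot_le_norm u v : dot u v <= `|u| * `|v|.
Proof.
have [->|u0] := eqVneq u 0; first by rewrite linear0l normr0 mul0r.
have [->|v0] := eqVneq v 0; first by rewrite linear0r normr0 mulr0.
have up : 0 < `|u| by rewrite normr_gt0.
have vp : 0 < `|v| by rewrite normr_gt0.
have := sqr_ge0 `| `|v| *: u - `|u| *: v |.
rewrite sqr_normB !normrZ !normr_id dotZl dotZr.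
have uv : 0 < `|u| * `|v| by rewrite mulr_gt0.
move=> h; rewrite -(ler_pM2l uv); nra.
Qed.

(** Half-spaces are closed: a point of the closure where [dot u] is positive
    would, by Cauchy-Schwarz, have a whole ball around it where [dot u] is. *)
Lemma polar_closure C u : polar dot C u -> polar dot (closure C) u.
Proof.
move=> uC w wC; rewrite leNgt; apply/negP => uw.
have e0 : 0 < dot u w / (`|u| + 1).
  by rewrite divr_gt0// ltr_wpDl.
have [z [Cz]] := wC _ (nbhsx_ballx w _ e0).
rewrite -ball_normE/= ltr_pdivlMr ?ltr_wpDl// => wz.
have := dot_le_norm u (w - z); have := uC _ Cz.
rewrite linearBr/=; have := normr_ge0 (w - z); nra.
Qed.

Lemma convex_segment {C y z} {t : R} : convex_set C -> C y -> C z ->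
  0 <= t -> t <= 1 -> C (y + t *: (z - y)).
Proof.
move=> cC Cy Cz t0 t1.
have := cC z y (Itv01 t0 t1) (mem_set Cz) (mem_set Cy).
move/set_mem; congr (C _); rewrite /conv/= /unstable.onem.
by rewrite scalerBl scale1r scalerBr addrCA.
Qed.

(** If the angle at the nearest point [p] were acute, a short move from [p]
    towards [y] would come closer to [x]. *)
Lemma nearest_angle C x p y : convex_set C -> nearest C x p -> C y ->
  dot (x - p) (y - p) <= 0.
Proof.
move=> cC [Cp xp] Cy; rewrite leNgt; apply/negP => c0.
set c := dot _ _ in c0; set q := `|y - p| ^+ 2.
have q0 : 0 <= q by rewrite sqr_ge0.
have cq : 0 < c + q by rewrite ltr_pwDl.
(* a step length in ]0, 1] that makes the quadratic term smaller than the
   linear one *)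
pose t := c / (c + q).
have t0 : 0 < t by rewrite divr_gt0.
have t1 : t <= 1 by rewrite ler_pdivrMr// mul1r lerDl.
have := xp _ (convex_segment cC Cp Cy (ltW t0) t1).
rewrite opprD addrA -(@ler_pXn2r _ 2)// ?nnegrE//.
rewrite (sqr_normB (x - p)) normrZ exprMn dotZr -/c -/q.
rewrite (ger0_norm (ltW t0)) => h.
have tq : t * q <= c.
  rewrite /t mulrAC ler_pdivrMr//; nra.
have : t * (2 * c) <= t * c by nra.
rewrite ler_pM2l//; lra.
Qed.

(** The parallelogram identity, applied at the midpoint of two points of [C]
    whose distances to [x] are almost minimal. *)
Lemma almost_nearest_close C x y z (m e : R) : convex_set C ->
  (forall w, C w -> m <= `|x - w| ^+ 2) -> C y -> C z ->
  `|x - y| ^+ 2 <= m + e -> `|x - z| ^+ 2 <= m + e -> `|y - z| ^+ 2 <= 4 * e.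
Proof.
move=> cC mC Cy Cz xy xz.
have half0 : 0 <= 2^-1 :> R by rewrite invr_ge0.
have half1 : 2^-1 <= 1 :> R by rewrite invf_le1// ler1n.
have := mC _ (convex_segment cC Cy Cz half0 half1).
have zyE : z - y = (x - y) - (x - z) by rewrite opprB [RHS]addrC subrKA.
rewrite opprD addrA zyE (sqr_normB (x - y)) normrZ exprMn (ger0_norm half0).
rewrite dotZr linearBr/= -norm_dot (sqr_normB (x - y)).
rewrite (distrC y) zyE (sqr_normB (x - y)); nra.
Qed.

(** A minimizing sequence is Cauchy by the previous estimate, and its limit
    attains the infimum of the squared distances. *)
Lemma nearest_exists C x : C !=set0 -> closed C -> convex_set C ->
  nearest C x !=set0.
Proof.
move=> [c0 Cc0] clC cC.
pose D := [set `|x - y| ^+ 2 | y in C].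
have lbD : lbound D 0 by move=> _ [y _ <-]; exact: sqr_ge0.
have hinf : has_inf D.
  by split; [exists (`|x - c0| ^+ 2), c0 | exists 0].
have mC w : C w -> inf D <= `|x - w| ^+ 2.
  by move=> Cw; apply: ge_inf; [case: hinf | exists w].
have /choice[y yP] : forall n : nat, exists w,
    C w /\ `|x - w| ^+ 2 <= inf D + n.+1%:R^-1.
  move=> n; have n0 : 0 < n.+1%:R^-1 :> R by rewrite invr_gt0.
  by have [_ [w Cw <-] /ltW] := inf_adherent n0 hinf; exists w.
have yC n : C (y n) by have [] := yP n.
have cvgy : cvg (y @ \oo).
  apply: cauchy_cvg; apply: cauchy_exP => e e0.
  have e20 : 0 < e ^+ 2 / 4 by rewrite divr_gt0 ?exprn_gt0.
  have [N _ NP] := near_infty_natSinv_lt (PosNum e20).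
  exists (y N); exists N => // n /= Nn.
  rewrite -ball_normE/= -(@ltr_pXn2r _ 2)// ?nnegrE ?(ltW e0)//.
  apply: (@le_lt_trans _ _ (4 * N.+1%:R^-1)).
    apply: (almost_nearest_close C x _ _ (inf D)) => //; first exact: (yP N).2.
    apply: (le_trans (yP n).2); rewrite lerD2l lef_pV2 ?posrE//.
    by rewrite ler_nat.
  by have := NP N (leqnn N); rewrite /= ltr_pdivlMr// mulrC.
exists (lim (y @ \oo)); split.
  by apply: (closed_cvg C clC _ _ cvgy); near=> n.
move=> w Cw; rewrite -(@ler_pXn2r _ 2)// ?nnegrE//.
apply: le_trans (mC _ Cw).
have cvgd : `|x - y n| ^+ 2 @[n --> \oo] --> `|x - lim (y @ \oo)| ^+ 2.
  rewrite expr2; under eq_fun do rewrite expr2.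
  by apply: cvgM; apply: cvg_norm; apply: cvgB => //; exact: cvg_cst.
have cvgi : inf D + n.+1%:R^-1 @[n --> \oo] --> inf D + 0.
  by apply: cvgD; [exact: cvg_cst | exact: cvg_harmonic].
rewrite -(addr0 (inf D)).
by apply: (ler_cvg_to cvgd cvgi); near=> n; exact: (yP n).2.
Unshelve. all: by end_near. Qed.

Lemma metric_proj_nearest C x : C !=set0 -> closed C -> convex_set C ->
  nearest C x (metric_proj C x).
Proof. by move=> C0 clC cC; apply: getPex; exact: nearest_exists. Qed.

(** Lower bounds pass to the infimum: a count of steps that holds against every
    solution also holds against the distance to the solution set. *)
Lemma sqr_dist_set_ge C x (c : R) : C !=set0 -> 0 <= c ->
  (forall y, C y -> c <= `|x - y| ^+ 2) -> c <= dist_set x C ^+ 2.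
Proof.
move=> [y0 Cy0] c0 cC; rewrite -[leLHS]sqr_sqrtr//.
have le_dist : Num.sqrt c <= dist_set x C.
  apply: lb_le_inf; first by exists `|y0 - x|, y0.
  move=> _ [y Cy <-]; rewrite -[leRHS]normr_id -sqrtr_sqr ler_wsqrtr//.
  by rewrite distrC cC.
by rewrite ler_pXn2r// nnegrE ?(le_trans _ le_dist)// sqrtr_ge0.
Qed.

Lemma sub_tangent_cone C x y : C y -> tangent_cone C x (y - x).
Proof.
move=> Cy; apply: subset_closure; exists 1; first exact: ltr01.
by exists y => //; rewrite invr1 scale1r.
Qed.

(** The angle condition at a projection bounds [dot (x - p)] on the directions
    [y - p] only; scaling and passing to the closure extend it to the tangent
    cone. *)
Lemma nearest_normal_cone C x p : convex_set C -> nearest C x p ->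
  normal_cone dot C p (x - p).
Proof.
move=> cC xp; apply: polar_closure => _ [l l0 [y Cy <-]].
rewrite dotZr pmulr_rle0 ?invr_gt0//.
exact: nearest_angle xp Cy.
Qed.

(** * The implicit step *)

Variables (X : set H) (F : H -> H).
Hypotheses (X_closed : closed X) (X_convex : convex_set X).
Hypothesis F_monotone : monotone_on dot X F.
Let S := VI_sol dot F X.

(** The vector [alpha v / |v|] has norm [alpha], hence equals [F p + w] with [w]
    in the polar of a set containing [v].  Pairing with [v] gives
    [alpha |v| = dot (F p) v + dot w v], whose last term is nonpositive. *)
Lemma sharp_ge_norm (alpha : R) p v : weakly_sharp_modulus dot F X alpha ->
  S p -> tangent_cone X p v -> normal_cone dot S p v ->
  alpha * `|v| <= dot (F p) v.
Proof.
move=> [_ sharp] Sp Tv Nv.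
have [->|v0] := eqVneq v 0; first by rewrite normr0 mulr0 linear0r.
have vp : `|v| != 0 by rewrite normr_eq0.
have ball_v : closed_ball (0 : H) 1 (`|v|^-1 *: v).
  rewrite closed_ballE// /closed_ball_/= sub0r normrN normrZ normfV normr_id.
  by rewrite mulVf.
have [w wP Fw] := sharp _ Sp _ (imageP (fun b => alpha *: b) ball_v).
have := wP v (conj Tv Nv).
have -> : w = alpha *: (`|v|^-1 *: v) - F p by rewrite -Fw addrC addKr.
rewrite linearBl/= !dotZl -norm_dot expr2 mulKf//.
by rewrite subr_le0.
Qed.

(** One step [z = P_X (y - g F z)], encoded by the variational inequality which
    characterizes the projection: this is the only form in which the
    convergence argument uses it. *)
Definition VI_step (g : R) y z := X z /\
  forall w, X w -> dot (y - z) (w - z) <= g * dot (F z) (w - z).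

Lemma metric_proj_VI_step (g : R) y z : X z ->
  z = metric_proj X (y - g *: F z) -> VI_step g y z.
Proof.
move=> Xz zE; split=> // w Xw; rewrite -subr_le0.
have near_z : nearest X (y - g *: F z) z.
  by rewrite [X in nearest _ _ X]zE; apply: metric_proj_nearest => //; exists z.
have := nearest_angle X _ _ w X_convex near_z Xw.
by rewrite addrAC linearBl/= dotZl.
Qed.

Lemma VI_step_fejer (g : R) y z s : 0 <= g -> VI_step g y z -> S s ->
  `|z - s| ^+ 2 + `|y - z| ^+ 2 <= `|y - s| ^+ 2.
Proof.
move=> g0 [Xz step] [Xs sol].
have := step _ Xs; have := sol _ Xz; have := F_monotone _ _ Xz Xs.
have -> : y - s = (y - z) - (s - z) by rewrite opprB subrKA.
rewrite (sqr_normB (y - z)) (distrC s) -(opprB z s) !linearNr linearBl/=.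
nra.
Qed.

Lemma VI_step_length (alpha a g : R) y z :
  S !=set0 -> closed S -> convex_set S -> weakly_sharp_modulus dot F X alpha ->
  0 < alpha -> 0 < a -> a <= g -> VI_step g y z -> ~ S z ->
  a * alpha <= `|y - z|.
Proof.
move=> S0 clS cS sharp al0 a0 ag [Xz step] nSz.
have [p zp] := nearest_exists S z S0 clS cS; have Sp := zp.1.
have Xp := Sp.1.
have zp0 : 0 < `|z - p|.
  by rewrite normr_gt0 subr_eq0; apply/eqP => zpE; apply: nSz; rewrite zpE.
have := sharp_ge_norm _ _ _ sharp Sp (sub_tangent_cone _ _ _ Xz)
  (nearest_normal_cone _ _ _ cS zp).
have := F_monotone _ _ Xz Xp; have := step _ Xp.
have := dot_le_norm (y - z) (z - p).
rewrite -(opprB z p) !linearNr !linearBl/= => cs st mono sh.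
rewrite -(ler_pM2r zp0) (le_trans _ cs)//.
have Fz : alpha * `|z - p| <= dot (F z) (z - p) by lra.
have al_zp : 0 < alpha * `|z - p| by rewrite mulr_gt0.
nra.
Qed.

End InnerProduct.

(** * Finite termination *)

Theorem theorem4p6 (R : realType) (H : completeNormedModType R)
    (dot : {dot H for idfun})
    (norm_dot : forall x : H, `|x| ^+ 2 = dot x x)
    (X : set H) (F : H -> H)
    (X_nonempty : X !=set0) (X_closed : closed X) (X_convex : convex_set X)
    (F_monotone : monotone_on dot X F)
    (sol_nonempty : VI_sol dot F X !=set0)
    (sol_closed : closed (VI_sol dot F X))
    (sol_convex : convex_set (VI_sol dot F X))
    (alpha : R) (alpha_gt0 : 0 < alpha)
    (sol_sharp : weakly_sharp_modulus dot F X alpha)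
    (a : R) (a_gt0 : 0 < a)
    (gamma : nat -> R) (gamma_ge : forall n, (1 <= n)%N -> a <= gamma n)
    (x : nat -> H)
    (x_in : forall n, (1 <= n)%N -> X (x n.+1))
    (x_rec : forall n, (1 <= n)%N ->
       x n.+1 = metric_proj X (x n - gamma n *: F (x n.+1))) :
  exists l : nat,
    [/\ (1 <= l)%N,
        l%:R <= dist_set (x 1%N) (VI_sol dot F X) ^+ 2 / (a ^+ 2 * alpha ^+ 2) + 1,
        VI_sol dot F X (x l.+1) &
        forall n, (l.+1 <= n)%N -> x n = x l.+1].
Proof.
set S := VI_sol dot F X.
have step n : VI_step dot X F (gamma n.+1) (x n.+1) (x n.+2).
  by apply: (metric_proj_VI_step dot norm_dot) => //; [exact: x_in | exact: x_rec].
have gamma_ge0 n : 0 <= gamma n.+1.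
  by rewrite (le_trans (ltW a_gt0)) ?gamma_ge.
have fejer n s (Ss : S s) :=
  VI_step_fejer dot norm_dot X F F_monotone _ _ _ s (gamma_ge0 n) (step n) Ss.
set c := a ^+ 2 * alpha ^+ 2.
have c0 : 0 < c by rewrite mulr_gt0// exprn_gt0.
have steplen n : ~ S (x n.+2) -> c <= `|x n.+1 - x n.+2| ^+ 2.
  move=> nS; rewrite /c -exprMn ler_pXn2r ?nnegrE//; last first.
    by rewrite mulr_ge0// ltW.
  by apply: (VI_step_length dot norm_dot X F F_monotone _ _ (gamma n.+1)) => //;
    exact: gamma_ge.
have miss_le m s : S s -> (forall k, (k < m)%N -> ~ S (x k.+2)) ->
    m%:R * c <= `|x 1%N - s| ^+ 2.
  move=> Ss miss.
  suff: m%:R * c + `|x m.+1 - s| ^+ 2 <= `|x 1%N - s| ^+ 2.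
    by apply: le_trans; rewrite lerDl sqr_ge0.
  elim: m miss => [|m IHm] miss; first by rewrite mul0r add0r.
  have := IHm (fun k km => miss k (ltnW km)).
  have := steplen _ (miss m (ltnSn m)); have := fejer m s Ss.
  rewrite -natr1 mulrDl mul1r; lra.
have hit : exists k, `[< S (x k.+2) >].
  apply: contrapT => nhit; have [s Ss] := sol_nonempty.
  have miss k : ~ S (x k.+2) by move=> Sk; apply: nhit; exists k; apply/asboolP.
  have := miss_le (Num.bound (`|x 1%N - s| ^+ 2 / c)) s Ss (fun k _ => miss k).
  rewrite -ler_pdivlMr// leNgt => /negP; apply.
  by apply: archi_boundP; rewrite divr_ge0 ?sqr_ge0// ltW.
(* [x_1] is an arbitrary starting point, so only the steps reaching
   [x_2, x_3, ...] are counted: the first [k] of them miss [S] and the next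
   one hits it, whence [l = k + 1]. *)
case: (ex_minnP hit) => k /asboolP Sk kmin.
exists k.+1; split=> //.
  rewrite -natr1 lerD2r ler_pdivlMr//; apply: sqr_dist_set_ge => //.
    by rewrite mulr_ge0// ltW.
  move=> s Ss; apply: miss_le => // j jk Sj.
  by move: jk; rewrite ltnNge => /negP; apply; apply: kmin; apply/asboolP.
move=> n; elim: n => // n IHn.
rewrite leq_eqVlt => /predU1P[<- //|kn].
have xn := IHn kn; case: n xn kn {IHn} => // n xn kn.
have := fejer n _ Sk; rewrite xn subrr normr0 expr0n/= => h.
apply/eqP; rewrite -subr_eq0 -normr_eq0 -sqrf_eq0 eq_le sqr_ge0 andbT.
by apply: le_trans h; rewrite lerDl sqr_ge0.
Qed.
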